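(* Let $S=S_1\cup\dots\cup S_k$ be a curve with intersection data $a_{ij}$ as described in the context, and let $F$ be a line bundle of multi-degree $0$ on $S$. Let $p_i\in S_i$, $i=1,\dots,k$, be different from all intersection points, and suppose that $F(k-1)[-p_1-\dots-p_k]\notin\Theta$. For $l\in\{1,\dots,k\}$ let $s_l=(Q_1(\zeta),\dots,Q_k(\zeta))$ be the (unique up to a constant multiple) section of $F(k-1)$ which vanishes at $p_j$ for all $j\ne l$. Then, up to a constant multiple, the polynomial $Q_l(\zeta)$ is given by $$Q_l(\zeta)=\Lambda_F\bigl(\pi(p_1),\dots,\pi(p_{l-1}),\zeta,\pi(p_{l+1}),\dots,\pi(p_k)\bigr),$$ with $\zeta$ in the $l$-th place.
   Context: The curve: $S$ is a union of $k$ copies $S_1,\dots,S_k$ of $\mathbb{P}^1$ with a map $\pi:S\to\mathbb{P}^1$ restricting to an isomorphism on each $S_i$; each pair $S_i,S_j$ ($i\ne j$) meets in exactly two points, all intersection points are distinct ordinary double points. The images under $\pi$ of the two points of $S_i\cap S_j$ are $a_{ij},a_{ji}$, all assumed $\ne\infty$. The arithmetic genus is $g=(k-1)^2$. Line bundles: a line bundle $F$ of multi-degree $(0,\dots,0)$ is trivial on each $S_i$ and is given by gluing data at the intersection points. It is represented by $(\lambda_{ij},\mu_{ij})\in(\mathbb{C}^*\times\mathbb{C}^* )^{k(k-1)}$ ($i\ne j$) so that, for $n\ge0$, a section of $F(n)=F\otimes\pi^*\mathcal{O}(n)$ is a $k$-tuple $(Q_1,\dots,Q_k)$ of polynomials in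 $\zeta$ of degree at most $n$ satisfying $\lambda_{ij}Q_i(a_{ij})+\mu_{ij}Q_j(a_{ij})=0$ for all $i\ne j$, $Q_i$ representing the section on $S_i$ (vanishing at the point over $\infty$ meaning that the coefficient of $\zeta^n$ is $0$). Here $E[-D]=E\otimes\mathcal{O}_S(-D)$, and $\Theta$ is the set of line bundles of multi-degree $(k-2,\dots,k-2)$ having a non-zero section. Theta function: $\vartheta(\lambda_{ij},\mu_{ij})=\det\Xi$, where $\Xi$ is the $k(k-1)\times k(k-1)$ matrix with rows labelled by pairs $(i,j)$, $i\neq j$, and columns by $(m,n)$, $1\le m\le k$, $0\le n\le k-2$ (both in lexicographic order), whose entry is $\lambda_{ij}a_{ij}^n$ if $m=i$, $\mu_{ij}a_{ij}^n$ if $m=j$, and $0$ otherwise (extended as a polynomial to $(\mathbb{C}\times\mathbb{C})^{k(k-1)}$). The function $\Lambda_F$: put $s_{ij}(u)=\lambda_{ij}(a_{ij}-u)$, $t_{ij}(u)=\mu_{ij}(a_{ij}-u)$, with the convention $s_{ij}(\infty)=\lambda_{ij}$, $t_{ij}(\infty)=\mu_{ij}$, and $$\Lambda_F(u_1,\dots,u_k)=\vartheta\bigl(s_{ij}(u_i),t_{ij}(u_j)\bigr).$$ It is a polynomial of degree at most $k-1$ in each variable. *)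

(* Defs.v *)
From mathcomp Require Import all_boot all_order all_algebra.
From mathcomp Require Import reals.
From mathcomp.real_closed Require Export complex.

Set Implicit Arguments.
Unset Strict Implicit.
Unset Printing Implicit Defensive.

Import GRing.Theory.
Local Open Scope ring_scope.

(* The projective line over K in the affine coordinate zeta, with [None] the
   point at infinity.  Each component S_i is identified with it through pi, so
   a point of S_i is written as its image under pi. *)
Definition proj_line (K : Type) := option K.

(* [node i j] and [node j i] are the images under pi of the two points of
   S_i \cap S_j; the diagonal values are meaningless.  The nodes are required
   to be distinct as points of S: two nodes lying on a common component have
   distinct images, while nodes on disjoint pairs of components may have the
   same image. *)
Record curve (K : fieldType) (k : nat) := Curve {
  node : 'I_k -> 'I_k -> K;
  node_pair : forall i j, i != j -> node i j != node j i;
  node_triple : forall i j m, i != j -> i != m -> j != m ->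
    uniq [:: node i j; node j i; node i m; node m i] }.

Definition smooth_at (K : fieldType) (k : nat) (S : curve K k) (i : 'I_k)
    (x : proj_line K) : bool :=
  [forall j, (j != i) ==> (x != Some (node S i j)) && (x != Some (node S j i))].

Definition smooth_point (K : fieldType) (k : nat) (S : curve K k) (i : 'I_k) :=
  {x : option K | smooth_at S i x}.

(* Gluing data of a line bundle of multi-degree (0, ..., 0); only the
   off-diagonal values are meaningful. *)
Record line_bundle0 (K : fieldType) (k : nat) := LineBundle0 {
  lam : 'I_k -> 'I_k -> K;
  mu : 'I_k -> 'I_k -> K;
  lam_neq0 : forall i j, i != j -> lam i j != 0;
  mu_neq0 : forall i j, i != j -> mu i j != 0 }.

(* The line bundle F(n)[-D], where D is an effective divisor supported on
   smooth points of S, given on each S_i as a list of points with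
   multiplicity.  Every line bundle of multi-degree (d, ..., d) with d >= 0 is
   of this form with D = 0. *)
Record line_bundle (K : fieldType) (k : nat) (S : curve K k) := LineBundle {
  base : line_bundle0 K k;
  twist : nat;
  zeros : forall i : 'I_k, seq (smooth_point S i) }.

Definition multidegree (K : fieldType) (k : nat) (S : curve K k)
    (E : line_bundle S) (i : 'I_k) : int :=
  (twist E)%:Z - (size (zeros E i))%:Z.

(* Q, seen as a section of O(n) on the projective line, vanishes to order at
   least m at x; at infinity, the coefficients of zeta^n, ..., zeta^(n-m+1)
   are 0. *)
Definition vanishes (K : fieldType) (n m : nat) (x : proj_line K)
    (Q : {poly K}) : bool :=
  if x is Some c then ('X - c%:P) ^+ m %| Q else (size Q <= n.+1 - m)%N.

(* Global sections of F(n)[-D], as the sections of F(n) that vanish on D. *)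
Definition is_section (K : fieldType) (k : nat) (S : curve K k)
    (E : line_bundle S) (Q : {ffun 'I_k -> {poly K}}) : Prop :=
  [/\ forall i, (size (Q i) <= (twist E).+1)%N,
      forall i j, i != j ->
        lam (base E) i j * (Q i).[node S i j]
        + mu (base E) i j * (Q j).[node S i j] = 0
    & forall i (x : smooth_point S i), x \in zeros E i ->
        vanishes (twist E) (count_mem x (zeros E i)) (val x) (Q i)].

Definition Theta (K : fieldType) (k : nat) (S : curve K k)
    (E : line_bundle S) : Prop :=
  (forall i, multidegree E i = k%:Z - 2%:Z)
  /\ exists2 Q : {ffun 'I_k -> {poly K}}, is_section E Q & Q != 0.

(* The inverse of [mxvec_index]: 'I_(m * n) lists 'I_m * 'I_n in
   lexicographic order. *)
Definition lex_pair (m n : nat) (r : 'I_(m * n)) : 'I_m * 'I_n :=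
  enum_val (cast_ord (esym (mxvec_cast m n)) r).

(* [lift i] is increasing with image the indices different from i, so
   (i, j') |-> (i, lift i j') lists the pairs (i, j), i != j, in
   lexicographic order. *)
Definition Xi (K : fieldType) (k : nat) (S : curve K k)
    (s t : 'I_k -> 'I_k -> K) : 'M[K]_(k * k.-1) :=
  \matrix_(r, c)
    let i := (lex_pair r).1 in
    let j := lift i (lex_pair r).2 in
    let m := (lex_pair c).1 in
    let n := (lex_pair c).2 in
    if m == i then s i j * node S i j ^+ n
    else if m == j then t i j * node S i j ^+ n
    else 0.

Definition theta (K : fieldType) (k : nat) (S : curve K k)
    (s t : 'I_k -> 'I_k -> K) : K :=
  \det (Xi S s t).

Definition twisted_coef (K : fieldType) (c a : K) (u : proj_line K) : K :=
  if u is Some v then c * (a - v) else c.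

Definition Lambda (K : fieldType) (k : nat) (S : curve K k)
    (F : line_bundle0 K k) (u : 'I_k -> proj_line K) : K :=
  theta S (fun i j => twisted_coef (lam F i j) (node S i j) (u i))
          (fun i j => twisted_coef (mu F i j) (node S i j) (u j)).

(* Main.v *)
Require Import Defs.
From mathcomp Require Import all_boot all_order all_algebra.
From mathcomp Require Import reals.
From mathcomp.real_closed Require Import complex.
From mathcomp Require Import ring zify.

Set Implicit Arguments.
Unset Strict Implicit.
Unset Printing Implicit Defensive.

Import GRing.Theory.
Local Open Scope ring_scope.

(** Write a section of [F(k-1)] vanishing at [p_j], [j <> l], as
    [Q_j = (X - u_j) W_j] for [j <> l] (or [Q_j = W_j] when [u_j = oo]) and
    [Q_l = a + X W_l]: its coefficients [(a, W)] form a vector of length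
    [1 + k(k-1)].  Let [N(z)] be the square matrix sending it to the value
    [Q_l(z)] together with the gluing conditions.  Passing from the basis
    [1, X^n.+1] to [1, (X - z) X^n] is unimodular and makes [N(z)] block
    triangular, so [\det N(z) = Lambda].  Only the first column of [N(z)]
    depends on [z], and the section spans the kernel of the others, so by
    Cramer's rule [\det N(z)] is proportional to [Q_l(z)]; the constant is
    nonzero because uniqueness of the section makes [N(z0)] invertible as soon
    as [Q_l(z0) != 0]. *)

(** * Lexicographic indexing of pairs, and a form of Cramer's rule *)

Lemma index_allpairs_pair (T1 T2 : eqType) (s : seq T1) (t : seq T2) x y :
  x \in s -> y \in t ->
  index (x, y) [seq (x1, x2) | x1 <- s, x2 <- t]
  = (index x s * size t + index y t)%N.
Proof.
move=> + yt; elim: s => [//|x0 s IHs]; rewrite inE allpairs_cons index_cat /=.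
have pair_inj (z : T1) : injective (fun b : T2 => (z, b)) by move=> ? ? [].
have [<- _|neq /= xs] := eqVneq x0 x.
  by rewrite mem_map ?yt ?index_map.
rewrite ifN; last by apply/mapP => -[b _ [xE _]]; rewrite xE eqxx in neq.
by rewrite size_map IHs // mulSn addnA.
Qed.

(** Positions in the lexicographic order become explicit numbers, so that triangularity for that
    order can be checked. *)
Lemma val_mxvec_index (m n : nat) (i : 'I_m) (j : 'I_n) :
  mxvec_index i j = (i * n + j)%N :> nat.
Proof.
rewrite /mxvec_index /=.
have rank_lt : (enum_rank (i, j) < size (enum {: 'I_m * 'I_n}))%N.
  by rewrite -cardE ltn_ord.
rewrite -(index_uniq (i, j) rank_lt (enum_uniq _)).
rewrite nth_enum_rank enumT unlock.
by rewrite index_allpairs_pair ?mem_enum // size_enum_ord !index_enum_ord.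
Qed.

Lemma lex_pair_index {m n : nat} (i : 'I_m) (j : 'I_n) :
  lex_pair (mxvec_index i j) = (i, j).
Proof. by rewrite /lex_pair cast_ordK enum_rankK. Qed.

Lemma mxvec_index_lex_pair {m n : nat} (r : 'I_(m * n)) :
  mxvec_index (lex_pair r).1 (lex_pair r).2 = r.
Proof. by rewrite /mxvec_index -surjective_pairing enum_valK cast_ordKV. Qed.

Lemma val_lex_pair (m n : nat) (r : 'I_(m * n)) :
  r = ((lex_pair r).1 * n + (lex_pair r).2)%N :> nat.
Proof. by rewrite -val_mxvec_index mxvec_index_lex_pair. Qed.

Lemma sum_lex_pair (V : nmodType) (m n : nat) (f : 'I_m -> 'I_n -> V) :
  \sum_(r < m * n) f (lex_pair r).1 (lex_pair r).2
  = \sum_(i < m) \sum_(j < n) f i j.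
Proof.
rewrite pair_bigA /= (reindex (fun p : 'I_m * 'I_n => mxvec_index p.1 p.2)) /=.
  by apply: eq_bigr => -[i j] _; rewrite lex_pair_index.
by exists (@lex_pair m n) => [[i j] _|r _]; 
  rewrite ?lex_pair_index ?mxvec_index_lex_pair.
Qed.

(* As functions of [c], both sides are linear forms vanishing on the columns of
   [M], hence proportional; they agree at [c0]. *)
Lemma det_row_mx_kernel (K : fieldType) (n : nat) (M : 'M[K]_(1 + n, n))
    (c c0 : 'cV[K]_(1 + n)) (v : 'rV[K]_(1 + n)) :
  v *m M = 0 -> row_mx c0 M \in unitmx ->
  \det (row_mx c M) * (v *m c0) 0 0 = \det (row_mx c0 M) * (v *m c) 0 0.
Proof.
move=> vM N0u; pose N0 := row_mx c0 M.
pose x := invmx N0 *m c.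
have cE : c = N0 *m x by rewrite mulKVmx.
(* Replacing the first column of [N0] by [c] is right multiplication by a block triangular matrix
   whose determinant is the first coordinate of [x]. *)
have NE : row_mx c M = N0 *m block_mx (usubmx x) 0 (dsubmx x) 1%:M.
  rewrite block_mxEh vsubmxK mul_mx_row -cE; congr row_mx.
  by rewrite mul_row_col mulmx0 add0r mulmx1.
rewrite NE det_mulmx det_lblock det1 mulr1 det_mx11 -mulrA; congr (_ * _).
rewrite [in RHS]cE mulmxA mul_mx_row vM -[x in RHS]vsubmxK mul_row_col mul0mx.
by rewrite addr0 [RHS]mxE big_ord1 mulrC.
Qed.

(** * The matrix [Xi] acting on tuples of polynomials *)

Lemma horner_rVpoly_sum (K : fieldType) (n : nat) (v : 'rV[K]_n) (a : K) :
  (rVpoly v).[a] = \sum_(j < n) v 0 j * a ^+ j.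
Proof.
rewrite (horner_coef_wide _ (size_poly _ _)).
by apply: eq_bigr => j _; rewrite coef_rVpoly_ord.
Qed.

(** Row (i, j) of [Xi] is a gluing condition at [node S i j], as a linear form in the coefficients;
    only the blocks of [i] and [j] contribute. *)
Lemma mul_mxvec_Xi (K : fieldType) (k : nat) (S : curve K k)
    (s t : 'I_k -> 'I_k -> K) (W : 'M[K]_(k, k.-1)) r :
  let i := (lex_pair r).1 in
  let j := lift i (lex_pair r).2 in
  (mxvec W *m (Xi S s t)^T) 0 r
  = s i j * (rVpoly (row i W)).[node S i j]
    + t i j * (rVpoly (row j W)).[node S i j].
Proof.
move=> i j; rewrite !horner_rVpoly_sum mxE.
pose f m n := W m n * (if m == i then s i j * node S i j ^+ n
                       else if m == j then t i j * node S i j ^+ n else 0).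
rewrite (eq_bigr (fun c => f (lex_pair c).1 (lex_pair c).2)); last first.
  by move=> c _; rewrite -{1}(mxvec_index_lex_pair c) mxvecE !mxE.
have neq_ji : j != i by rewrite eq_sym neq_lift.
rewrite sum_lex_pair (bigD1 i) //= (bigD1 j) //=.
rewrite [X in _ + (_ + X)]big1 ?addr0 => [|m]; last first.
  case/andP=> /negPf mi /negPf mj.
  by apply: big1 => n _; rewrite /f mi mj mulr0.
by rewrite !mulr_sumr; congr (_ + _); apply: eq_bigr => n _;
   rewrite /f ?eqxx ?(negPf neq_ji) !mxE mulrCA.
Qed.

(** * Vanishing at a point of the projective line *)

(** At infinity the factor is 1: a zero there lowers the degree bound, so in both cases the bound on
    the cofactor drops by one. *)
Definition local_factor {K : fieldType} (x : proj_line K) : {poly K} :=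
  if x is Some c then 'X - c%:P else 1.

Lemma local_factor_neq0 (K : fieldType) (x : proj_line K) :
  local_factor x != 0.
Proof. by case: x => [c|] /=; rewrite ?polyXsubC_eq0 ?oner_eq0. Qed.

(** The source of the twisted coefficients in [Lambda]: splitting off a zero at [x] multiplies the
    gluing coefficient by the value of the factor at the node. *)
Lemma horner_local_factor (K : fieldType) (x : proj_line K) (c a : K)
    (q : {poly K}) :
  c * (local_factor x * q).[a] = twisted_coef c a x * q.[a].
Proof. by case: x => [v|]; rewrite !hornerE /= ?mulr1. Qed.

Lemma size_local_factorM (K : fieldType) (x : proj_line K) (n : nat)
    (q : {poly K}) :
  (size q <= n)%N -> (size (local_factor x * q)%R <= n.+1)%N.
Proof.
case: x => [c|] /= sq; last by rewrite mul1r (leq_trans sq).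
have [->|q0] := eqVneq q 0; first by rewrite mulr0 size_poly0.
by rewrite size_monicM ?monicXsubC // size_XsubC.
Qed.

Lemma vanishesP (K : fieldType) (n : nat) (x : proj_line K) (Q : {poly K}) :
  (size Q <= n.+1)%N ->
  vanishes n 1 x Q <->
  exists2 q : {poly K}, (size q <= n)%N & Q = local_factor x * q.
Proof.
case: x => [c|] /= sQ; last first.
  by rewrite subn1; split=> [sq|[q sq ->]];
    [exists Q; rewrite ?mul1r | rewrite mul1r].
rewrite expr1; split=> [/dvdpP[q QE]|[q _ ->]]; last exact: dvdp_mulIl.
exists q; last by rewrite QE mulrC.
have [->|q0] := eqVneq q 0; first by rewrite size_poly0.
by move: sQ; rewrite QE mulrC size_monicM ?monicXsubC // size_XsubC.
Qed.

(** The value of a section of O(n) in a local trivialization; being linear in [Q], it allows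
    sections to be subtracted. *)
Definition proj_eval {K : fieldType} (n : nat) (x : proj_line K)
    (Q : {poly K}) : K :=
  if x is Some c then Q.[c] else Q`_n.

Lemma proj_eval_lin (K : fieldType) (n : nat) (x : proj_line K) (c : K)
    (P Q : {poly K}) :
  proj_eval n x (P - c *: Q) = proj_eval n x P - c * proj_eval n x Q.
Proof. by case: x => [v|] /=; rewrite ?hornerE // coefB coefZ. Qed.

Lemma vanishes_eval (K : fieldType) (n : nat) (x : proj_line K) (Q : {poly K}) :
  (size Q <= n.+1)%N -> vanishes n 1 x Q = (proj_eval n x Q == 0).
Proof.
case: x => [c|] /= sQ; first by rewrite expr1 dvdp_XsubCl.
rewrite subn1 /=; apply/idP/eqP => [/leq_sizeP->//|Qn].
apply/leq_sizeP => j; rewrite leq_eqVlt => /predU1P[<-//|nj].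
by move/leq_sizeP: sQ => ->.
Qed.

(** * Coordinates on the sections vanishing at [u j] for all [j != l] *)

Section Sections.

Variables (K : fieldType) (k : nat) (S : curve K k) (F : line_bundle0 K k).
Variables (u : 'I_k -> proj_line K) (l : 'I_k).

Definition glue (Q : 'I_k -> {poly K}) : 'rV[K]_(k * k.-1) :=
  \row_r let i := (lex_pair r).1 in let j := lift i (lex_pair r).2 in
    lam F i j * (Q i).[node S i j] + mu F i j * (Q j).[node S i j].

Lemma glue_eq0 (Q : 'I_k -> {poly K}) :
  glue Q = 0 <->
  forall i j, i != j ->
    lam F i j * (Q i).[node S i j] + mu F i j * (Q j).[node S i j] = 0.
Proof.
split=> [gQ i j ij|gQ]; last first.
  by apply/rowP => r; rewrite !mxE /=; apply/gQ/neq_lift.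
have [j' jE|jE] := unliftP i j; last by rewrite jE eqxx in ij.
by have := congr1 (fun v : 'rV__ => v 0 (mxvec_index i j')) gQ;
   rewrite !mxE lex_pair_index /= -jE.
Qed.

Definition with_point (z : K) : 'I_k -> proj_line K :=
  fun j => if j == l then Some z else u j.

Definition Xi_at (z : K) : 'M[K]_(k * k.-1) :=
  Xi S (fun i j => twisted_coef (lam F i j) (node S i j) (with_point z i))
       (fun i j => twisted_coef (mu F i j) (node S i j) (with_point z j)).

(** Splitting off ['X] at the place [l], rather than ['X - z%:P], keeps the coordinates independent
    of the evaluation point. *)
Definition param_section (a : K) (W : 'M[K]_(k, k.-1)) (m : 'I_k) : {poly K} :=
  if m == l then a%:P + 'X * rVpoly (row m W)
  else local_factor (u m) * rVpoly (row m W).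

Definition unit_glue : 'rV[K]_(k * k.-1) :=
  glue (fun m => if m == l then 1 else 0).

(** Without its constant [a], component [l] has a zero at 0, whence [Xi_at 0]. *)
Lemma glue_param_section (a : K) (W : 'M[K]_(k, k.-1)) :
  glue (param_section a W) = a *: unit_glue + mxvec W *m (Xi_at 0)^T.
Proof.
apply/rowP => r; rewrite [LHS]mxE [RHS]mxE mul_mxvec_Xi !mxE /=.
set i := (lex_pair r).1; set j := lift i _.
have valE c m : c * (param_section a W m).[node S i j] =
    a * (c * (if m == l then 1 else 0 : {poly K}).[node S i j])
    + twisted_coef c (node S i j) (with_point 0 m)
      * (rVpoly (row m W)).[node S i j].
  rewrite /param_section /with_point; case: eqP => [_|_].
    by rewrite /= hornerD hornerM !hornerC hornerX; ring.
  by rewrite horner_local_factor horner0 !mulr0 add0r.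
by rewrite !valE; ring.
Qed.

Definition power_col (z : K) : 'cV[K]_(k * k.-1) :=
  \col_r if (lex_pair r).1 == l then z ^+ (lex_pair r).2.+1 else 0.

Lemma horner_param_section (a : K) (W : 'M[K]_(k, k.-1)) (z : K) :
  (param_section a W l).[z] = a + (mxvec W *m power_col z) 0 0.
Proof.
rewrite /param_section eqxx !hornerE horner_rVpoly_sum mulr_sumr; congr (_ + _).
rewrite mxE.
pose f m n := W m n * (if m == l then z ^+ n.+1 else 0).
rewrite [RHS](eq_bigr (fun c => f (lex_pair c).1 (lex_pair c).2)); last first.
  by move=> c _; rewrite -{1}(mxvec_index_lex_pair c) mxvecE !mxE.
rewrite sum_lex_pair (bigD1 l) //= [X in _ + X]big1 ?addr0 => [|m /negPf ml].
  by apply: eq_bigr => n _; rewrite /f eqxx mxE exprS mulrCA.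
by apply: big1 => n _; rewrite /f ml mulr0.
Qed.

Lemma param_section_eq0 (a : K) (W : 'M[K]_(k, k.-1)) :
  (forall m, param_section a W m = 0) -> a = 0 /\ W = 0.
Proof.
move=> Q0; have rowE m : rVpoly (row m W) = 0 -> row m W = 0.
  by move/(congr1 (@poly_rV K k.-1)); rewrite rVpolyK linear0.
have /polyP Ql := Q0 l; rewrite /param_section eqxx in Ql.
split; first by have := Ql 0%N; rewrite coefD coefC coefXM coef0 addr0.
apply/row_matrixP => m; rewrite row0; apply: rowE.
have [->|ml] := eqVneq m l.
  apply/polyP => n; have := Ql n.+1.
  by rewrite coefD coefC coefXM !coef0 add0r.
have /eqP := Q0 m; rewrite /param_section (negPf ml) mulf_eq0.
by rewrite (negPf (local_factor_neq0 _)) /= => /eqP.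
Qed.

Definition off_l_section (Q : 'I_k -> {poly K}) : Prop :=
  [/\ forall i, (size (Q i) <= k.-1.+1)%N, glue Q = 0
    & forall j, j != l -> vanishes k.-1 1 (u j) (Q j)].

Lemma param_sectionP (Q : 'I_k -> {poly K}) :
  off_l_section Q <->
  exists a W, Q =1 param_section a W /\ glue (param_section a W) = 0.
Proof.
have szP a W i : (size (param_section a W i) <= k.-1.+1)%N.
  rewrite /param_section; case: eqP => _; last first.
    by rewrite size_local_factorM ?size_poly.
  rewrite (leq_trans (size_polyD _ _)) // geq_max.
  rewrite (leq_trans (size_polyC_leq1 _)) //=.
  by rewrite (leq_trans (size_polyMleq _ _)) // size_polyX ltnS size_poly.
have glueE (Q1 Q2 : 'I_k -> {poly K}) : Q1 =1 Q2 -> glue Q1 = glue Q2.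
  by move=> eQ; apply/rowP => r; rewrite !mxE /= !eQ.
split=> [[szQ gQ vQ]|[a [W [QE gQ]]]]; last first.
  split=> [i||j jl]; [by rewrite QE | by rewrite (glueE _ _ QE) |].
  rewrite QE; apply/vanishesP => //; exists (rVpoly (row j W)).
    exact: size_poly.
  by rewrite /param_section (negPf jl).
(* One statement covers both cases, so that [fin_all_exists] yields all cofactors as a single
   function. *)
have vQ' j : exists q : {poly K}, (size q <= k.-1)%N
    && (if j == l then Q j == ((Q j)`_0)%:P + 'X * q
        else Q j == local_factor (u j) * q).
  have [_|jl] := eqVneq j l.
    exists (drop_poly 1 (Q j)); rewrite size_drop_poly leq_subLR szQ /=.
    apply/eqP/polyP => n; rewrite coefD coefC coefXM coef_drop_poly.
    by case: n => [|n]; rewrite ?addr0 // add0r addn1.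
  by have /(vanishesP _ (szQ j))[q sq ->] := vQ j jl; exists q; rewrite sq /=.
have [q qP] := fin_all_exists vQ'.
have QE : Q =1 param_section (Q l)`_0 (\matrix_m poly_rV (q m)).
  move=> m; have /andP[sq] := qP m.
  rewrite /param_section rowK poly_rV_K //.
  by have [->|_] := eqVneq m l => /eqP.
by exists (Q l)`_0, (\matrix_m poly_rV (q m)); split; rewrite -?(glueE _ _ QE).
Qed.

(** * The square system and its determinant *)

Definition gluing_mx : 'M[K]_(1 + k * k.-1, k * k.-1) :=
  col_mx unit_glue (Xi_at 0)^T.

Definition eval_col (z : K) : 'cV[K]_(1 + k * k.-1) := col_mx 1 (power_col z).

Lemma mul_gluing_mx (a : K) (W : 'M[K]_(k, k.-1)) :
  row_mx a%:M (mxvec W) *m gluing_mx = glue (param_section a W).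
Proof. by rewrite mul_row_col mul_scalar_mx glue_param_section. Qed.

Lemma mul_eval_col (a : K) (W : 'M[K]_(k, k.-1)) (z : K) :
  (row_mx a%:M (mxvec W) *m eval_col z) 0 0 = (param_section a W l).[z].
Proof.
by rewrite mul_row_col mul_scalar_mx horner_param_section !mxE eqxx mulr1.
Qed.

Lemma param_rowE (v : 'rV[K]_(1 + k * k.-1)) :
  v = row_mx (lsubmx v 0 0)%:M (mxvec (vec_mx (rsubmx v))).
Proof. by rewrite -mx11_scalar vec_mxK hsubmxK. Qed.

(* Subtracting [z] times row [(l, n)] from row [(l, n.+1)] passes from the
   basis [X^n.+1] to the basis [(X - z) X^n]. *)
Lemma det_eval_gluing (z : K) :
  \det (row_mx (eval_col z) gluing_mx) = Lambda S F (with_point z).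
Proof.
(* Left multiplication by [L] shifts the rows of block [l] down by one and kills the other
   blocks. *)
pose L : 'M[K]_(k * k.-1) := \matrix_(r, r')
  [&& (lex_pair r).1 == l, (lex_pair r').1 == l
    & (lex_pair r).2 == (lex_pair r').2.+1 :> nat]%:R.
pose U := 1%:M - z *: L.
(* The lowest new vector of the block, ['X - z%:P], involves the constant 1, which corresponds to
   the extra first row. *)
pose w : 'cV[K]_(k * k.-1) := \col_r
  if ((lex_pair r).1 == l) && ((lex_pair r).2 == 0 :> nat) then - z else 0.
have detU : \det U = 1.
  (* The pair (l, n) strictly precedes (l, n.+1), so [U] is lower triangular with unit diagonal. *)
  have Lz (r r' : 'I_(k * k.-1)) : (r <= r')%N -> L r r' = 0.
    rewrite mxE (val_lex_pair r) (val_lex_pair r').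
    case: and3P => // -[/eqP-> /eqP-> /eqP->].
    by rewrite leq_add2l ltnn.
  have UE r r' : U r r' = (r == r')%:R - z * L r r' by rewrite 3!mxE [L]lock !mxE.
  rewrite det_trig; last first.
    apply/is_trig_mxP => r r' rr'.
    by rewrite UE Lz 1?ltnW // -val_eqE (ltn_eqF rr') mulr0 subr0.
  by apply: big1 => r _; rewrite UE Lz // eqxx mulr0 subr0.
have LS p (X : 'M[K]_(k * k.-1, p)) r c (n : 'I_k.-1) :
    (lex_pair r).1 = l -> (lex_pair r).2 = n.+1 :> nat ->
    (L *m X) r c = X (mxvec_index l n) c.
  move=> rl rn; rewrite mxE (bigD1 (mxvec_index l n)) //= big1 => [|r' r'n].
    by rewrite mxE lex_pair_index rl rn !eqxx mul1r addr0.
  rewrite mxE; case: and3P => [[_ /eqP r'l]|]; rewrite ?mul0r //.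
  rewrite rn eqSS => /eqP nE.
  by case/eqP: r'n; rewrite -(mxvec_index_lex_pair r') r'l (val_inj nE).
have L0 p (X : 'M[K]_(k * k.-1, p)) r c :
    ((lex_pair r).1 != l) || ((lex_pair r).2 == 0 :> nat) -> (L *m X) r c = 0.
  move=> r0; rewrite mxE big1 // => r' _; rewrite mxE.
  case: and3P => [[/eqP rl _ /eqP rn]|]; rewrite ?mul0r //.
  by rewrite rl rn eqxx in r0.
have UE p (X : 'M[K]_(k * k.-1, p)) r c :
    (U *m X) r c = X r c - z * (L *m X) r c.
  by rewrite mulmxBl mul1mx -scalemxAl [LHS]mxE; congr (_ + _); rewrite !mxE.
(* In the new basis only the constant 1 is nonzero at [z], which gives the first column; moving the
   zero from 0 to [z] turns [Xi_at 0] into [Xi_at z]. *)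
have UN : block_mx 1%:M 0 w U *m row_mx (eval_col z) gluing_mx
          = block_mx 1%:M unit_glue 0 (Xi_at z)^T.
  rewrite -block_mxEh mulmx_block !mul1mx !mul0mx !addr0 mulmx1.
  congr block_mx; apply/matrixP => r c.
    rewrite [LHS]mxE UE [w r c]mxE [power_col z r c]mxE [RHS]mxE.
    case: eqP => [rl|/eqP rl] /=; last by rewrite L0 ?rl // mulr0 subr0 addr0.
    case rn: (nat_of_ord (lex_pair r).2) => [|n].
      by rewrite L0 ?rn ?orbT // mulr0 subr0 expr1 addNr.
    have nk : (n < k.-1)%N by rewrite ltnW // -rn.
    rewrite (LS _ _ _ _ (Ordinal nk)) // mxE lex_pair_index eqxx add0r.
    by rewrite -exprS subrr.
  rewrite [LHS]mxE UE [(w *m _) r c]mxE big_ord1 [w r 0]mxE [unit_glue 0 c]mxE.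
  rewrite ![_^T r c]mxE ![Xi_at _ c r]mxE /=.
  set i := (lex_pair c).1; set j := lift i _.
  have ji : j != i by rewrite eq_sym neq_lift.
  case: eqP => [rl|/eqP rl] /=; last first.
    rewrite L0 ?rl // mul0r add0r mulr0 subr0 /with_point.
    by case: eqP => [<-|_]; rewrite ?(negPf rl) //; case: eqP => [<-|//];
       rewrite (negPf rl).
  rewrite rl /with_point; case rn: (nat_of_ord (lex_pair r).2) => [|n].
    rewrite L0 ?rn ?orbT // mulr0 subr0 expr0 !mulr1 !(eq_sym l).
    case: (eqVneq i l) => [il|_]; [have jl : j != l by rewrite -il|].
      rewrite (negPf jl) /= hornerC horner0; ring.
    case: (eqVneq j l) => _ /=; rewrite ?hornerC ?horner0; ring.
  have nk : (n < k.-1)%N by rewrite ltnW // -rn.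
  rewrite (LS _ _ _ _ (Ordinal nk)) // !mxE lex_pair_index /= -/i -/j.
  rewrite /with_point.
  rewrite mul0r add0r !(eq_sym l).
  case: (eqVneq i l) => _ /=; first by rewrite exprS; ring.
  by case: (eqVneq j l) => _ /=; rewrite ?exprS; ring.
have := congr1 determinant UN.
by rewrite det_mulmx det_lblock det_ublock detU !det1 !mul1r det_tr.
Qed.

(** * Existence, uniqueness and proportionality to [Lambda] *)

Lemma exists_off_l_section :
  exists2 Q, off_l_section Q & ~ (forall m, Q m = 0).
Proof.
(* There is one more unknown than gluing conditions. *)
have : kermx gluing_mx != 0.
  by rewrite kermx_eq0 -row_leq_rank -ltnNge ltnS rank_leq_col.
case/rowV0Pn=> v /sub_kermxP; rewrite (param_rowE v).
set a := lsubmx v 0 0; set W := vec_mx _ => vN v0.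
exists (param_section a W).
  by apply/param_sectionP; exists a, W; rewrite -mul_gluing_mx.
case/param_section_eq0=> a0 W0; case/eqP: v0.
by rewrite a0 W0 raddf0 linear0 row_mx0.
Qed.

(** Polynomial form of the absence of nonzero sections of F(k-1)[-p_1-...-p_k]. *)
Hypothesis no_section : forall Q : 'I_k -> {poly K}, off_l_section Q ->
  vanishes k.-1 1 (u l) (Q l) -> forall m, Q m = 0.

(** By [no_section] the value at [u l] determines a section, so the constant is the ratio of the two
    values there. *)
Lemma off_l_section_unique (Q Q' : 'I_k -> {poly K}) :
  off_l_section Q -> ~ (forall m, Q m = 0) -> off_l_section Q' ->
  exists c, forall m, Q' m = c *: Q m.
Proof.
move=> HQ Q0 HQ'; have [szQ /glue_eq0 gQ vQ] := HQ.
have [szQ' /glue_eq0 gQ' vQ'] := HQ'.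
have w0 : proj_eval k.-1 (u l) (Q l) != 0.
  by apply/eqP => w0; apply/Q0/no_section; rewrite // vanishes_eval // w0.
pose c := proj_eval k.-1 (u l) (Q' l) / proj_eval k.-1 (u l) (Q l).
pose D m := Q' m - c *: Q m.
have szD m : (size (D m) <= k.-1.+1)%N.
  rewrite (leq_trans (size_polyD _ _)) // geq_max szQ' size_polyN.
  exact: leq_trans (size_scale_leq _ _) (szQ m).
exists c => m; apply/eqP; rewrite -subr_eq0; apply/eqP; move: m.
apply: (no_section (Q := D)); last first.
  by rewrite vanishes_eval // proj_eval_lin divfK // subrr.
split=> // [|j jl].
  apply/glue_eq0 => i j ij; rewrite /D !hornerE.
  transitivity (0 - c * 0 : K); last by rewrite mulr0 subrr.
  by rewrite -{1}(gQ' i j ij) -(gQ i j ij); ring.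
have := vQ' j jl; have := vQ j jl; rewrite !vanishes_eval // proj_eval_lin.
by move=> /eqP-> /eqP->; rewrite mulr0 subrr.
Qed.

Lemma off_l_section_neq0 (Q : 'I_k -> {poly K}) :
  off_l_section Q -> ~ (forall m, Q m = 0) -> Q l != 0.
Proof.
move=> HQ Q0; apply/eqP => Ql0; apply: Q0; apply: no_section => //.
by rewrite Ql0 vanishes_eval ?size_poly0 //; case: (u l) => [c|] /=;
   rewrite ?horner0 ?coef0.
Qed.

Lemma off_l_section_Lambda (Q : 'I_k -> {poly K}) (z0 : K) :
  off_l_section Q -> (Q l).[z0] != 0 ->
  exists2 c, c != 0 & forall z, (Q l).[z] = c * Lambda S F (with_point z).
Proof.
move=> HQ Qz0; have Q0 : ~ (forall m, Q m = 0).
  by move=> Q0; rewrite Q0 horner0 eqxx in Qz0.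
(* A left kernel vector encodes a section whose component [l] vanishes at [z0]; it is a multiple of
   [Q], and the factor is 0 because [(Q l).[z0] != 0]. *)
have N0u : row_mx (eval_col z0) gluing_mx \in unitmx.
  rewrite unitmxE unitfE; apply/det0P => -[v]; rewrite (param_rowE v).
  set a := lsubmx v 0 0; set W := vec_mx _ => v0.
  rewrite mul_mx_row mul_gluing_mx => /eqP.
  rewrite row_mx_eq0 => /andP[/eqP/matrixP/(_ 0 0) + /eqP gW].
  rewrite mul_eval_col mxE => Wz0.
  have /(off_l_section_unique HQ Q0)[c cE] : off_l_section (param_section a W).
    by apply/param_sectionP; exists a, W.
  move: Wz0; rewrite cE hornerZ => /eqP.
  rewrite mulf_eq0 (negPf Qz0) orbF => /eqP c0.
  have [m|a0 W0] := @param_section_eq0 a W; first by rewrite cE c0 scale0r.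
  by case/eqP: v0; rewrite a0 W0 raddf0 linear0 row_mx0.
have [a [W [QE]]] := (param_sectionP Q).1 HQ; rewrite -mul_gluing_mx => vN.
have N0d : \det (row_mx (eval_col z0) gluing_mx) != 0.
  by rewrite -unitfE -unitmxE.
exists ((Q l).[z0] / \det (row_mx (eval_col z0) gluing_mx)).
  by rewrite mulf_neq0 // invr_eq0.
move=> z; have := det_row_mx_kernel (eval_col z) vN N0u.
rewrite !mul_eval_col -!QE det_eval_gluing => e.
by apply: (mulfI N0d); rewrite -e; field.
Qed.

End Sections.

(** * From tuples of polynomials back to line bundles *)

Theorem proposition3p5 (R : realType) (k : nat) (S : curve R[i] k)
    (F : line_bundle0 R[i] k) (p : forall i : 'I_k, smooth_point S i)
    (hp : ~ Theta (LineBundle F k.-1 (fun i => [:: p i])))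
    (l : 'I_k) :
  let E := LineBundle F k.-1 (fun j => if j == l then [::] else [:: p j]) in
  [/\ exists2 s : {ffun 'I_k -> {poly R[i]}}, is_section E s & s != 0,
      forall s s' : {ffun 'I_k -> {poly R[i]}},
        is_section E s -> s != 0 -> is_section E s' ->
        exists c : R[i], s' = [ffun i => c *: s i]
    & forall s : {ffun 'I_k -> {poly R[i]}}, is_section E s -> s != 0 ->
        exists2 c : R[i], c != 0
        & forall z : R[i],
            (s l).[z]
            = c * Lambda S F (fun j => if j == l then Some z else val (p j))].
Proof.
move=> E; pose u j := val (p j) : proj_line R[i].
(* Each list of zeros has at most one entry, so only simple vanishing occurs. *)
have sE (s : {ffun 'I_k -> {poly R[i]}}) :
    is_section E s <-> off_l_section S F u l s.
  split=> [[sz gl vs]|[sz gl vs]]; split=> //; first exact/glue_eq0.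
  - move=> j jl; have := vs j (p j); rewrite /= (negPf jl) inE eqxx /= eqxx.
    exact.
  - exact/glue_eq0.
  move=> j x; rewrite /=; case: eqVneq => [//|jl].
  by rewrite inE => /eqP->; rewrite /= eqxx; apply: vs.
have s0E (s : {ffun 'I_k -> {poly R[i]}}) : s != 0 <-> ~ (forall m, s m = 0).
  split=> [/eqP s0 sm0|s0].
    by apply: s0; apply/ffunP => m; rewrite sm0 ffunE.
  by apply/eqP => sm0; apply: s0 => m; rewrite sm0 ffunE.
have no_section (Q : 'I_k -> {poly R[i]}) : off_l_section S F u l Q ->
    vanishes k.-1 1 (u l) (Q l) -> forall m, Q m = 0.
  move=> [sz /glue_eq0 gl vs] vl m; apply/eqP/negP => /negP Qm.
  apply: hp; split.
    (* The index [l] forces k > 0, so [k.-1] is not truncated and the degree is k - 2. *)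
    by move=> i; rewrite /multidegree /=; have := ltn_ord l; lia.
  exists [ffun m => Q m]; last first.
    by apply/s0E => /(_ m); rewrite ffunE => /eqP; apply/negP.
  split=> [i|i j ij|i x]; rewrite !ffunE //; first exact: gl.
  rewrite inE => /eqP->; rewrite /= eqxx /= -/(u i).
  by have [->//|] := eqVneq i l; apply: vs.
split.
- have [Q [sz /glue_eq0 gl vs] Q0] := exists_off_l_section S F u l.
  exists [ffun m => Q m]; last first.
    by apply/s0E => sm0; apply: Q0 => m; have := sm0 m; rewrite ffunE.
  apply/sE; split=> [i||j jl]; rewrite ?ffunE //; last exact: vs.
  by apply/glue_eq0 => i j ij; rewrite !ffunE; apply: gl.
- move=> s s' /sE Hs /s0E s0 /sE Hs'.
  have [c cE] := off_l_section_unique no_section Hs s0 Hs'.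
  by exists c; apply/ffunP => m; rewrite ffunE.
move=> s /sE Hs /s0E s0.
(* Over the algebraically closed field [R[i]] the nonzero polynomial [s l] has a nonroot, used to
   normalize the constant. *)
have /closed_nonrootP[z0 z0P] := off_l_section_neq0 no_section Hs s0.
exact: (off_l_section_Lambda no_section Hs z0P).
Qed.
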